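(* Let $\lambda$ be a nonzero real number. For integers $n\ge 0$ let $(x)_{0,\lambda}=1$ and $(x)_{n,\lambda}=x(x-\lambda)\cdots(x-(n-1)\lambda)$ for $n\ge1$. Define the degenerate Eulerian polynomials by $\sum_{j=0}^{\infty}(j+1)_{n,\lambda}x^{j}=\frac{A_{n,\lambda}(x)}{(1-x)^{n+1}}$ for $|x|<1$, and the degenerate Eulerian numbers by $A_{n,\lambda}(x)=\sum_{k=0}^{n}A_{\lambda}(n,k)x^{k}$, with the convention $A_\lambda(n,k)=0$ if $k<0$ or $k>n$. Then for $n\ge1$ and $0\le k\le n$, \[A_{\lambda}(n,k)=\big((n-k)+(n-1)\lambda\big)A_{\lambda}(n-1,k-1)+\big(k+1-(n-1)\lambda\big)A_{\lambda}(n-1,k).\] *)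

(* Defs.v *)
From HB Require Import structures.
From mathcomp Require Import all_boot all_order all_algebra.
From mathcomp Require Import all_classical all_reals all_analysis.
Set Implicit Arguments.
Unset Strict Implicit.
Unset Printing Implicit Defensive.
Import Order.TTheory GRing.Theory Num.Theory.
Import numFieldNormedType.Exports.
Local Open Scope classical_set_scope.
Local Open Scope ring_scope.

Definition deg_falling {R : realType} (lambda x : R) (n : nat) : R :=
  \prod_(i < n) (x - i%:R * lambda).

(* The size bound says that the degree is at most n, as is implicit in the
   expansion A_{n,lambda}(x) = \sum_(k <= n) A_lambda(n,k) x^k. *)
Definition deg_Eulerian_spec {R : realType} (lambda : R) (n : nat)
    (P : {poly R}) : Prop :=
  (size P <= n.+1)%N /\
  forall x : R, `|x| < 1 ->
    series (fun j : nat => deg_falling lambda (j%:R + 1) n * x ^+ j) @ \oo -->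
      P.[x] / (1 - x) ^+ n.+1.

(* Definite description: at most one polynomial satisfies the specification,
   since its values on ]-1, 1[ are determined; the default 0 would only be
   used if there were none. *)
Definition deg_Eulerian_poly {R : realType} (lambda : R) (n : nat) : {poly R} :=
  xget 0 [set P : {poly R} | deg_Eulerian_spec lambda n P].

(* The lower index ranges over int so that k - 1 is not truncated at k = 0. *)
Definition deg_Eulerian_number {R : realType} (lambda : R) (n : nat) (k : int)
    : R :=
  if (0 <= k <= n%:Z) then (deg_Eulerian_poly lambda n)`_(`|k|%N) else 0.

(* Main.v *)
Require Import Defs.
From HB Require Import structures.
From mathcomp Require Import all_boot all_order all_algebra.
From mathcomp Require Import all_classical all_reals all_analysis.
From mathcomp Require Import ring.
Set Implicit Arguments.
Unset Strict Implicit.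
Unset Printing Implicit Defensive.
Import Order.TTheory GRing.Theory Num.Theory.
Import numFieldNormedType.Exports.
Local Open Scope classical_set_scope.
Local Open Scope ring_scope.

(* With F_n = sum_j (j+1)_n x^j, the factor (j+1) - n lambda of (j+1)_(n+1)
   turns into F_(n+1) = x F_n' + (1 - n lambda) F_n; substituting
   F_n = A_n / (1-x)^(n+1) gives A_(n+1) = eulerian_step n A_n, whose
   coefficients are the recurrence.  Termwise differentiation of series is
   avoided by running the argument on partial sums, which are polynomials:
   (1-x)^(n+1) sum_(j<N) (j+1)_n x^j = A_n(x) - x^N Q_n(N, x) with Q_n
   polynomial in N and x, so that the error vanishes as N grows for |x| < 1. *)

Lemma natpow_geometric_cvg0 (R : realType) (m : nat) (x : R) :
  `|x| < 1 -> N%:R ^+ m * x ^+ N @[N --> \oo] --> (0 : R).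
Proof.
elim: m x => [|m IHm] x xlt1.
  rewrite (_ : (fun N : nat => N%:R ^+ 0 * x ^+ N) = GRing.exp x); last first.
    by apply/funext => N; rewrite expr0 mul1r.
  exact: cvg_expr.
(* [N z^N] is bounded, which absorbs one factor [N z^N] of
   [N^(m+1) |x|^N = (N z^N) (N^m z^N)]. *)
pose z := Num.sqrt `|x|.
have z0 : 0 <= z by exact: sqrtr_ge0.
have z2 : z * z = `|x| by rewrite -expr2 sqr_sqrtr.
have z1 : z < 1 by rewrite -(ltr_sqr z0 ler01) expr1n expr2 z2.
have bound N : N%:R * z ^+ N <= (1 - z)^-1.
  rewrite -[leRHS]mul1r ler_pdivlMr ?subr_gt0//.
  (* Each of the [N] powers [z ^+ j] with [j < N] is at least [z ^+ N]; their sum times [1 - z]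
     telescopes to [1 - z ^+ N]. *)
  have step : N%:R * z ^+ N * (1 - z) <= \sum_(j < N) z ^+ j * (1 - z).
    rewrite -mulr_suml; apply: ler_wpM2r; first by rewrite subr_ge0 ltW.
    rewrite -[N in N%:R]card_ord mulr_natl -sumr_const.
    by apply: ler_sum => j _; apply: ler_wiXn2l => //;
      [exact: ltW | exact: ltnW].
  apply: (le_trans step).
  rewrite -mulr_suml mulrC -opprB mulNr -subrX1 opprB.
  by rewrite gerBl exprn_ge0.
apply/norm_cvg0P.
have IHz : N%:R ^+ m * z ^+ N * (1 - z)^-1 @[N --> \oo] --> (0 : R).
  rewrite -[X in _ --> X](mul0r (1 - z)^-1).
  by apply: cvgMl; apply: IHm; rewrite ger0_norm.
apply: (squeeze_cvgr _ (cvg_cst 0) IHz); apply: nearW => N.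
rewrite normr_ge0 /= normrM !normrX -z2 exprMn ger0_norm ?ler0n// exprS.
rewrite mulrACA mulrC.
by rewrite ler_wpM2l// mulr_ge0// exprn_ge0// ler0n.
Qed.

(** Expanding [Q] in powers of [N] leaves finitely many terms, each a constant times some
    [N^i x^N]. *)
Lemma horner2_natpow_cvg0 (R : realType) (Q : {poly {poly R}}) (x : R) :
  `|x| < 1 -> x ^+ N * (Q.[N%:R]).[x] @[N --> \oo] --> (0 : R).
Proof.
move=> xlt1.
rewrite (_ : (fun N => _) = (fun N : nat =>
    \sum_(i < size Q) (Q`_i).[x] * (N%:R ^+ i * x ^+ N))); last first.
  apply/funext => N; rewrite (horner_coef Q) horner_sum mulr_sumr.
  apply: eq_bigr => i _; rewrite hornerM.
  rewrite -[X in _ * (_ * X.[x])](natrX {poly R} N i) -polyC_natr hornerC.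
  by rewrite natrX mulrCA [x ^+ N * _]mulrC.
rewrite -[X in _ --> X](@big1 _ 0 +%R 'I_(size Q) (index_enum _) xpredT
  (fun=> 0))//.
apply: cvg_big => [|i _]; first exact: add_continuous.
rewrite -(mulr0 (Q`_i).[x]).
by apply: cvgMr; exact: natpow_geometric_cvg0.
Qed.

(* The coefficients of [Q] are polynomials in x, its variable stands for the
   number N of terms; L acts on the coefficients only since N is a scalar. *)
Lemma raddf_horner_nat (R : nzRingType) (L : {additive {poly R} -> {poly R}})
    (Q : {poly {poly R}}) (N : nat) :
  L Q.[N%:R] = (map_poly L Q).[N%:R].
Proof.
rewrite horner_coef raddf_sum (@horner_coef_wide _ (size Q)) ?size_poly//.
apply: eq_bigr => i _; rewrite coef_map_id0 ?raddf0//.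
by rewrite -natrX !mulr_natr raddfMn.
Qed.

(** [P - Q] has at least as many roots as its size, namely 1/2, 1/3, and so on, starting at 1/2 to
    stay below 1. *)
Lemma eq_poly_horner_near0 (R : realType) (P Q : {poly R}) :
  (forall x, `|x| < 1 -> P.[x] = Q.[x]) -> P = Q.
Proof.
move=> PQ; apply/eqP; rewrite -subr_eq0; apply/eqP.
apply: (@roots_geq_poly_eq0 _ _
  [seq (i.+2%:R : R)^-1 | i <- iota 0 (size (P - Q))]).
- apply/allP => _ /mapP[i _ ->]; rewrite /root !hornerE PQ ?subrr//.
  by rewrite ger0_norm ?invr_ge0 ?ler0n// invf_lt1 ?ltr0n// ltr1n.
- rewrite map_inj_uniq ?iota_uniq// => i j /invr_inj /eqP.
  by rewrite eqr_nat => /eqP[].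
- by rewrite size_map size_iota.
Qed.

Section RationalGeneratingFunction.
Variables (R : realType) (lambda : R).

Definition eulerian_step (n : nat) (A : {poly R}) : {poly R} :=
  'X * (1 - 'X) * A^`() + n.+1%:R * 'X * A
  + (1 - n%:R * lambda)%:P * (1 - 'X) * A.

(** Lets [eulerian_step] pass through the difference [A_n - x^N Q_n] and act on [Q_n] coefficient by
    coefficient. *)
Fact eulerian_step_is_additive n : zmod_morphism (eulerian_step n).
Proof. by move=> A B; rewrite /eulerian_step derivB; ring. Qed.

HB.instance Definition _ n := GRing.isZmodMorphism.Build _ _
  (eulerian_step n) (eulerian_step_is_additive n).

Fixpoint eulerian_numerator (n : nat) : {poly R} :=
  if n is m.+1 then eulerian_step m (eulerian_numerator m) else 1.

Lemma coef_eulerian_step n (A : {poly R}) k :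
  (eulerian_step n A)`_k =
    (if k is j.+1 then (n%:R - j%:R + n%:R * lambda) * A`_j else 0)
    + (k%:R + 1 - n%:R * lambda) * A`_k.
Proof.
(* Each product is a shift by ['X] or a scaling, so coefficients can be read off termwise. *)
rewrite (_ : eulerian_step n A = 'X * A^`() - 'X * ('X * A^`())
    + ('X * A) *+ n.+1 + (1 - n%:R * lambda)%:P * A
    - (1 - n%:R * lambda)%:P * ('X * A)); last first.
  by rewrite /eulerian_step -[_ *+ n.+1]mulr_natl; ring.
rewrite !(coefD, coefN, coefMn, coefCM, coefXM, coef_deriv).
case: k => [|j] /=; first by rewrite mul0rn; ring.
have -> : (if j == 0%N then 0 else A`_j.-1.+1 *+ j.-1.+1) = j%:R * A`_j.
  by case: j => [|j] /=; rewrite ?mul0r ?mulr_natl.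
rewrite -(mulr_natl A`_j n.+1) -(mulr_natl A`_j.+1 j.+1) -(natr1 n) -(natr1 j).
ring.
Qed.

Lemma size_eulerian_numerator n : (size (eulerian_numerator n) <= n.+1)%N.
Proof.
elim: n => [|n IHn] /=; first by rewrite size_polyC oner_eq0.
apply/leq_sizeP => -[//|j] ltnj; rewrite coef_eulerian_step.
by rewrite !(leq_sizeP _ _ IHn) ?mulr0 ?addr0// ltnW.
Qed.

Lemma deg_fallingS x n :
  deg_falling lambda x n.+1 = deg_falling lambda x n * (x - n%:R * lambda).
Proof. by rewrite /deg_falling big_ord_recr. Qed.

Definition deg_falling_psum n N : {poly R} :=
  \sum_(j < N) (deg_falling lambda (j%:R + 1) n)%:P * 'X^j.

Lemma mulX_derivXn N : 'X * 'X^N^`() = N%:R * 'X^N :> {poly R}.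
Proof.
by rewrite derivXn mulrnAr mulr_natl; case: N => [|N]; rewrite -?exprS.
Qed.

Lemma deg_falling_psumS n N :
  deg_falling_psum n.+1 N = 'X * (deg_falling_psum n N)^`()
    + (1 - n%:R * lambda)%:P * deg_falling_psum n N.
Proof.
rewrite /deg_falling_psum raddf_sum !mulr_sumr -big_split/=.
apply: eq_bigr => j _; rewrite deg_fallingS derivM derivC mul0r add0r.
rewrite mulrCA mulX_derivXn -polyC_natr !(polyCB, polyCD, polyCM); ring.
Qed.

(** The passage from [F_n] to [F_(n+1)], stated for numerators without division; the extra factor
    [1 - 'X] clears the pole that differentiation adds. *)
Lemma eulerian_step_mul_exp n (G : {poly R}) :
  eulerian_step n ((1 - 'X) ^+ n.+1 * G)
  = (1 - 'X) ^+ n.+2 * ('X * G^`() + (1 - n%:R * lambda)%:P * G).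
Proof.
rewrite /eulerian_step derivM deriv_exp derivB derivC derivX sub0r /=.
rewrite !exprS -mulr_natl; ring.
Qed.

(** By the Leibniz rule the error stays a multiple of ['X^N], and its cofactor gains only one factor
    [N]. *)
Lemma eulerian_step_mulXn n N (B : {poly R}) :
  eulerian_step n ('X^N * B)
  = 'X^N * (N%:R * (1 - 'X) * B + eulerian_step n B).
Proof.
have XN := mulX_derivXn N.
rewrite /eulerian_step derivM.
rewrite (_ : 'X * (1 - 'X) * _ =
  (1 - 'X) * ('X * 'X^N^`() * B + 'X * 'X^N * B^`())); last by ring.
by rewrite XN; ring.
Qed.

Lemma deg_falling_psumE n : exists Q : {poly {poly R}}, forall N,
  (1 - 'X) ^+ n.+1 * deg_falling_psum n N
  = eulerian_numerator n - 'X^N * Q.[N%:R].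
Proof.
elim: n => [|n [Q IHn]].
  (* For [n = 0] this is the finite geometric sum, with error exactly ['X^N]. *)
  exists 1 => N; rewrite hornerC mulr1 /= expr1 -opprB mulNr.
  rewrite -[RHS]opprB subrX1; congr (- (_ * _)).
  by apply: eq_bigr => j _; rewrite /deg_falling big_ord0 mul1r.
(* The cofactor given by [eulerian_step_mulXn], with the outer ['X] standing for [N]. *)
exists ((1 - 'X)%:P * 'X * Q + map_poly (eulerian_step n) Q) => N.
rewrite deg_falling_psumS -eulerian_step_mul_exp IHn raddfB/=.
rewrite eulerian_step_mulXn raddf_horner_nat !hornerE.
by rewrite [(1 - 'X) * N%:R]mulrC.
Qed.

Lemma deg_Eulerian_spec_numerator n :
  deg_Eulerian_spec lambda n (eulerian_numerator n).
Proof.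
split=> [|x x1]; first exact: size_eulerian_numerator.
have [Q EQ] := deg_falling_psumE n.
have x10 : (1 - x) ^+ n.+1 != 0.
  by rewrite expf_neq0// subr_eq0 eq_sym lt_eqF// (le_lt_trans (ler_norm x)).
rewrite (_ : series _ = fun N : nat =>
    ((eulerian_numerator n).[x] - x ^+ N * Q.[N%:R].[x]) / (1 - x) ^+ n.+1).
  apply: cvgMl; rewrite -[X in _ --> X]subr0.
  by apply: cvgB; [exact: cvg_cst | exact: horner2_natpow_cvg0].
rewrite seriesEord; apply/funext => N.
apply: (canRL (mulfK x10)); rewrite mulrC.
have /(congr1 (fun p => p.[x])) := EQ N.
rewrite !(hornerM, hornerD, hornerN, horner_exp, hornerX, hornerC) => <-.
congr (_ * _); rewrite horner_sum; apply: eq_bigr => j _.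
by rewrite hornerM hornerC hornerXn.
Qed.

Lemma deg_Eulerian_spec_inj n (P Q : {poly R}) :
  deg_Eulerian_spec lambda n P -> deg_Eulerian_spec lambda n Q -> P = Q.
Proof.
move=> [_ limP] [_ limQ]; apply: eq_poly_horner_near0 => x x1.
have x10 : (1 - x) ^- n.+1 != 0.
  rewrite invr_eq0 expf_neq0// subr_eq0 eq_sym lt_eqF//.
  exact: le_lt_trans (ler_norm x) x1.
apply: (mulIf x10).
exact: (cvg_unique _ (limP x x1) (limQ x x1)).
Qed.

Lemma deg_Eulerian_polyE n :
  deg_Eulerian_poly lambda n = eulerian_numerator n.
Proof.
apply: xget_unique => [|P specP]; first exact: deg_Eulerian_spec_numerator.
exact: deg_Eulerian_spec_inj specP (deg_Eulerian_spec_numerator n).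
Qed.

Lemma deg_Eulerian_numberE n (k : nat) :
  deg_Eulerian_number lambda n k%:Z = (eulerian_numerator n)`_k.
Proof.
rewrite /deg_Eulerian_number deg_Eulerian_polyE lez_nat /=.
(* For [k > n] the convention gives 0, and so does the size bound. *)
by case: leqP => // nk; rewrite (leq_sizeP _ _ (size_eulerian_numerator n)).
Qed.

Lemma deg_Eulerian_numberN1 n : deg_Eulerian_number lambda n (-1) = 0.
Proof. by []. Qed.

End RationalGeneratingFunction.

Theorem theorem2p6 (R : realType) (lambda : R) (hlambda : lambda != 0)
    (n k : nat) (hn : (1 <= n)%N) (hk : (k <= n)%N) :
  deg_Eulerian_number lambda n k%:Z =
    ((n%:R - k%:R) + (n%:R - 1) * lambda)
      * deg_Eulerian_number lambda n.-1 (k%:Z - 1)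
    + (k%:R + 1 - (n%:R - 1) * lambda)
      * deg_Eulerian_number lambda n.-1 k%:Z.
Proof.
case: n hn hk => [//|n] _ _.
rewrite !deg_Eulerian_numberE /= coef_eulerian_step -natr1 addrK.
(* At [k = 0] the shifted index is -1, where the number is 0 by convention. *)
case: k => [|k]; first by rewrite sub0r deg_Eulerian_numberN1 mulr0.
rewrite (_ : k.+1%:Z - 1 = k%:Z); last by rewrite -addn1 PoszD addrK.
by rewrite deg_Eulerian_numberE -natr1; congr (_ * _ + _); ring.
Qed.
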